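(* Let $A$ be an algebra which is $\phi_n$-finite for some $n \geq 1$. Then $A$ is left weakly Gorenstein; that is, every module $M$ with $\operatorname{Ext}_A^i(M,A)=0$ for all $i>0$ is Gorenstein-projective.
   Context: Algebras are finite dimensional, connected and non-semisimple over a field $K$ (and may be assumed basic); modules are finite dimensional right modules; $\operatorname{mod-}A$ is the category of such modules. $\operatorname{Tr}$ denotes the Auslander-Bridger transpose. A module $M$ is Gorenstein-projective if $\operatorname{Ext}_A^i(M,A)=0$ and $\operatorname{Ext}_A^i(\operatorname{Tr}(M),A)=0$ for all $i \geq 1$. A module $M$ is semi-Gorenstein-projective if $\operatorname{Ext}_A^i(M,A)=0$ for all $i\ge 1$; the full subcategory of these modules is denoted ${}^{\perp}A$. $A$ is left weakly Gorenstein if every semi-Gorenstein-projective module is Gorenstein-projective, i.e. ${}^{\perp}A$ equals the subcategory of Gorenstein-projective modules. $\Omega^n(\operatorname{mod-}A)$ is the full subcategory of all direct sums of modules which are direct summands of $n$-th syzygy modules, including all projective modules. Put $\phi_n := {}^{\perp}A \cap \Omega^n(\operatorname{mod-}A)$. $A$ is $\phi_n$-finite if $\phi_n$ contains only finitely many indecomposable modules up to isomorphism. *)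

(* Defs.v *)
From HB Require Import structures.
From mathcomp Require Import all_boot all_order all_algebra all_field.

Set Implicit Arguments.
Unset Strict Implicit.
Unset Printing Implicit Defensive.

Import GRing.Theory.
Local Open Scope ring_scope.

(* The opposite algebra: MathComp only provides the ring structure of A^c. *)
Section OppositeAlgebra.
Variables (K : fieldType) (A : falgType K).

HB.instance Definition _ := GRing.Lmodule.copy A^c A.
HB.instance Definition _ := Vector.copy A^c A.

Fact opp_scalerAl (k : K) (a b : A^c) :
  k *: (a * b) = ((k *: a : A^c) * b : A^c).
Proof. exact: (@scalerAr K A k b a). Qed.

Fact opp_scalerAr (k : K) (a b : A^c) :
  k *: (a * b) = (a * (k *: b : A^c) : A^c).
Proof. exact: (@scalerAl K A k b a). Qed.

HB.instance Definition _ := GRing.Lmodule_isLalgebra.Build K A^c opp_scalerAl.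
HB.instance Definition _ := GRing.Lalgebra_isAlgebra.Build K A^c opp_scalerAr.
HB.instance Definition _ := GRing.UnitRing.on A^c.

End OppositeAlgebra.

Section Modules.
Variables (K : fieldType) (A : falgType K).

(* Finite dimensional right A-modules. Left A-modules are right modules over
   the opposite algebra A^c, whose product is a *' b = b * a. *)
Record rmod := RMod {
  rmod_sort :> vectType K;
  act : rmod_sort -> A -> rmod_sort;
  act_linearl : forall a, linear (act^~ a);
  act_linearr : forall x, linear (act x);
  act1 : forall x, act x 1 = x;
  actM : forall x a b, act x (a * b) = act (act x a) b }.

Definition regular_rmod : rmod := @RMod A *%R
  (fun a => linearP (a \o* idfun)) (fun x => linearP (x \*o idfun))
  (@mulr1 A) (@mulrA A).

Section DirectSum.
Variables M N : rmod.
Definition dsum_act (x : M * N) (a : A) : M * N := (act x.1 a, act x.2 a).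

Fact dsum_act_linearl a : linear (dsum_act^~ a).
Proof. by move=> k x y; rewrite /dsum_act /= !act_linearl. Qed.

Fact dsum_act_linearr x : linear (dsum_act x).
Proof. by move=> k a b; rewrite /dsum_act !act_linearr. Qed.

Fact dsum_act1 x : dsum_act x 1 = x.
Proof. by case: x => x y; rewrite /dsum_act !act1. Qed.

Fact dsum_actM x a b : dsum_act x (a * b) = dsum_act (dsum_act x a) b.
Proof. by rewrite /dsum_act !actM. Qed.

Definition dsum : rmod :=
  RMod dsum_act_linearl dsum_act_linearr dsum_act1 dsum_actM.
End DirectSum.

Definition is_hom (M N : rmod) (f : 'Hom(M, N)) :=
  forall x a, f (act x a) = act (f x) a.

Definition surjective (M N : rmod) (f : 'Hom(M, N)) := limg f = fullv.

Definition iso (M N : rmod) :=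
  exists f : 'Hom(M, N), is_hom f /\ bijective f.

Definition submodule (M : rmod) (U : {vspace M}) :=
  forall x a, x \in U -> act x a \in U.

Definition zero_module (M : rmod) := forall x : M, x = 0.

Definition direct_summand (X M : rmod) := exists Y, iso M (dsum X Y).

Definition indecomposable (M : rmod) :=
  ~ zero_module M /\
  forall X Y, iso M (dsum X Y) -> zero_module X \/ zero_module Y.

Definition simple_submodule (M : rmod) (U : {vspace M}) :=
  [/\ submodule U, U != 0%VS &
      forall V : {vspace M}, submodule V -> (V <= U)%VS -> V = 0%VS \/ V = U].

Definition semisimple_module (M : rmod) :=
  exists (n : nat) (U : 'I_n -> {vspace M}),
    [/\ forall i, simple_submodule (U i), (\sum_i U i)%VS = fullv &
        directv (\sum_i U i)].

Definition projective (P : rmod) :=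
  forall (M N : rmod) (g : 'Hom(M, N)) (f : 'Hom(P, N)),
    is_hom g -> surjective g -> is_hom f ->
  exists h : 'Hom(P, M), is_hom h /\ (g \o h)%VF = f.

Record proj_resolution (M : rmod) := ProjResolution {
  pr_obj :> nat -> rmod;
  pr_diff : forall i, 'Hom(pr_obj i.+1, pr_obj i);
  pr_aug : 'Hom(pr_obj 0, M);
  pr_projective : forall i, projective (pr_obj i);
  pr_diff_hom : forall i, is_hom (pr_diff i);
  pr_aug_hom : is_hom pr_aug;
  pr_aug_surj : surjective pr_aug;
  pr_exact0 : limg (pr_diff 0) = lker pr_aug;
  pr_exactS : forall i, limg (pr_diff i.+1) = lker (pr_diff i) }.

Definition cocycle (M N : rmod) (P : proj_resolution M) i (f : 'Hom(P i, N)) :=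
  is_hom f /\ (f \o pr_diff P i)%VF = 0.

Definition coboundary (M N : rmod) (P : proj_resolution M) i :
    'Hom(P i, N) -> Prop :=
  match i with
  | 0 => fun f => f = 0
  | j.+1 => fun f =>
      exists g : 'Hom(P j, N), is_hom g /\ f = (g \o pr_diff P j)%VF
  end.

(* Ext^i(M, N) = 0, i.e. H^i(Hom_A(P, N)) = 0. The choice of P is immaterial
   by the comparison theorem for projective resolutions. *)
Definition Ext_vanishes i (M N : rmod) :=
  forall (P : proj_resolution M) (f : 'Hom(P i, N)),
    cocycle f -> coboundary f.

Definition semi_Gorenstein_projective (M : rmod) :=
  forall i, (1 <= i)%N -> Ext_vanishes i M regular_rmod.

(* P is a projective cover of M: the kernel of p is superfluous. *)
Definition projective_cover (P M : rmod) (p : 'Hom(P, M)) :=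
  [/\ projective P, is_hom p, surjective p &
      forall U : {vspace P}, submodule U -> (U + lker p)%VS = fullv ->
        U = fullv].

(* X is isomorphic to the n-th syzygy of M. *)
Fixpoint syzygy (n : nat) (M X : rmod) : Prop :=
  match n with
  | 0 => iso X M
  | n'.+1 => exists (Y P : rmod) (p : 'Hom(P, Y)) (i : 'Hom(X, P)),
      [/\ syzygy n' M Y, projective_cover p, is_hom i,
          lker i = 0%VS & limg i = lker p]
  end.

(* Omega^n(mod-A): finite direct sums of projective modules and of direct
   summands of n-th syzygies. *)
Inductive Omega (n : nat) : rmod -> Prop :=
| Omega_projective P : projective P -> Omega n P
| Omega_summand M S X : syzygy n M S -> direct_summand X S -> Omega n X
| Omega_dsum X Y Z : Omega n X -> Omega n Y -> iso Z (dsum X Y) -> Omega n Z.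

Definition phi n (M : rmod) := semi_Gorenstein_projective M /\ Omega n M.

Definition phi_finite n :=
  exists (r : nat) (F : 'I_r -> rmod),
    forall M, phi n M -> indecomposable M -> exists i, iso M (F i).

End Modules.

(* Hom_A(M, A) as a left A-module, (a f)(x) = a (f x). *)
Section Dual.
Variables (K : fieldType) (A : falgType K) (M : rmod A).
Local Notation A_A := (regular_rmod A).

Definition hom_defect (f : 'Hom(M, A_A)) : 'Hom(A, 'Hom(M, A_A)) :=
  linfun (fun a => linfun (fun x : M => f (act x a) - f x * a)).

Lemma hom_defectE f a x : hom_defect f a x = f (act x a) - f x * a.
Proof.
have lin1 b : linear (fun x : M => f (act x b) - f x * b : A_A).
  move=> k y z; rewrite act_linearl !linearP mulrDl -scalerAl.
  by rewrite scalerBr opprD addrACA.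
have E1 b y : linfun (fun x : M => f (act x b) - f x * b : A_A) y
    = f (act y b) - f y * b.
  pose l1 : {linear M -> A_A} :=
    HB.pack (fun x : M => f (act x b) - f x * b : A_A)
      (GRing.isLinear.Build K M A_A _ _ (lin1 b)).
  exact: (lfunE l1).
have lin2 : linear
    (fun b => linfun (fun x : M => f (act x b) - f x * b : A_A)).
  move=> k b c; apply/lfunP=> y; rewrite add_lfunE scale_lfunE !E1.
  rewrite act_linearr linearP mulrDr -scalerAr.
  by rewrite scalerBr opprD addrACA.
pose l2 : {linear A -> 'Hom(M, A_A)} := HB.pack
    (fun b => linfun (fun x : M => f (act x b) - f x * b : A_A))
    (GRing.isLinear.Build K A 'Hom(M, A_A) _ _ lin2).
by rewrite /hom_defect (lfunE l2) /= E1.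
Qed.

Fact hom_defect_linear : linear hom_defect.
Proof.
move=> k f g; apply/lfunP=> a; apply/lfunP=> x.
rewrite !(add_lfunE, scale_lfunE, hom_defectE) mulrDl -scalerAl.
by rewrite scalerBr opprD addrACA.
Qed.

HB.instance Definition _ := GRing.isLinear.Build K
  'Hom(M, A_A) 'Hom(A, 'Hom(M, A_A)) _ hom_defect hom_defect_linear.

Definition dual_space : {vspace 'Hom(M, A_A)} := lker (linfun hom_defect).

Lemma dual_spaceP f : f \in dual_space <-> is_hom f.
Proof.
rewrite memv_ker lfunE /=; split=> [/eqP f0 x a | fh].
  by apply/eqP; rewrite -subr_eq0 -hom_defectE f0 !zero_lfunE.
apply/eqP/lfunP=> a; apply/lfunP=> x.
by rewrite hom_defectE !zero_lfunE fh subrr.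
Qed.

Fact dual_act_subproof (f : subvs_of dual_space) (a : A) :
  (amull a \o vsval f)%VF \in dual_space.
Proof.
apply/dual_spaceP=> x b; rewrite !comp_lfunE !lfunE /=.
by rewrite ((dual_spaceP _).1 (subvsP f)) /= mulrA.
Qed.

Definition dual_act (f : subvs_of dual_space) (a : A^c) : subvs_of dual_space :=
  Subvs (dual_act_subproof f a).

Fact dual_act_linearl a : linear (dual_act^~ a).
Proof.
move=> k f g; apply/val_inj/lfunP=> x.
by rewrite /= !(comp_lfunE, add_lfunE, scale_lfunE) !lfunE /= mulrDr -scalerAr.
Qed.

Fact dual_act_linearr f : linear (dual_act f).
Proof.
move=> k a b; apply/val_inj/lfunP=> x.
by rewrite /= !(comp_lfunE, add_lfunE, scale_lfunE) !lfunE /= mulrDl -scalerAl.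
Qed.

Fact dual_act1 f : dual_act f 1 = f.
Proof. by apply/val_inj/lfunP=> x; rewrite /= comp_lfunE lfunE /= mul1r. Qed.

Fact dual_actM f a b : dual_act f (a * b) = dual_act (dual_act f a) b.
Proof.
by apply/val_inj/lfunP=> x; rewrite /= !comp_lfunE !lfunE /= mulrA.
Qed.

Definition dual : rmod A^c :=
  RMod dual_act_linearl dual_act_linearr dual_act1 dual_actM.

End Dual.

Section Gorenstein.
Variables (K : fieldType) (A : falgType K).

(* T is a transpose of M: there is a projective presentation
   P1 -d-> P0 -e-> M -> 0 and an exact sequence of left A-modules
   Hom_A(P0, A) -d^*-> Hom_A(P1, A) -q-> T -> 0. It is determined by M up to
   projective direct summands. *)
Definition is_transpose (M : rmod A) (T : rmod A^c) :=
  exists (P1 P0 : rmod A) (d : 'Hom(P1, P0)) (e : 'Hom(P0, M))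
         (q : 'Hom(dual P1, T)),
  [/\ projective P1 /\ projective P0,
      is_hom d /\ is_hom e,
      surjective e /\ limg d = lker e,
      is_hom q /\ surjective q &
      forall f : dual P1,
        q f = 0 <-> exists g : dual P0, vsval f = (vsval g \o d)%VF].

Definition Gorenstein_projective (M : rmod A) :=
  semi_Gorenstein_projective M /\
  forall T, is_transpose M T -> semi_Gorenstein_projective T.

Definition left_weakly_Gorenstein :=
  forall M : rmod A, semi_Gorenstein_projective M -> Gorenstein_projective M.

Definition connected_algebra :=
  forall e : A, e * e = e -> (forall a, a * e = e * a) -> e = 0 \/ e = 1.

Definition semisimple_algebra := semisimple_module (regular_rmod A).

End Gorenstein.

(* Main.v *)
From HB Require Import structures.
Require Import Defs.
From mathcomp Require Import all_boot all_order all_algebra all_field.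
From Stdlib Require Import Classical.

(** Write sgp for semi-Gorenstein-projective, M* for Hom(M, A), and call the
    kernel of a surjection from a projective module onto M a syzygy of M.
    A module M is a stable retract of N when the identity of M is v u plus a
    map through a projective module, for some u : M -> N and v : N -> M.

    The proof has two halves.  The first shows that every sgp module is, up to
    stable retracts, a syzygy of another sgp module.  Taking syzygies respects
    stable retracts for any choice of the projective covers
    ([stable_retract_syzygy]); when the maps into A extend along the syzygy
    inclusions, which is what the vanishing of Ext^1(-, A) says, it also
    reflects them ([stable_retract_cosyzygy]).  Let C_m be the class of m-fold
    syzygies of sgp modules, up to stable retracts at each step.  These classes
    decrease, and a finite list of modules contains all indecomposable modules
    of phi_n; hence for some m >= n the classes C_m and C_(m+1) contain the
    same modules of the list.  If M is sgp, its m-th minimal syzygy S is in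
    C_m and is an n-th minimal syzygy of an sgp module, so its indecomposable
    summands are in phi_n, hence in the list, hence in C_(m+1), and therefore S
    is in C_(m+1).  Reflecting m times puts M itself in C_1
    ([sgp_stable_syzygy]).

    The second half derives Gorenstein-projectivity.  An sgp module M is now a
    direct summand of some Z with 0 -> Z -> P -> Y -> 0 exact, P projective and
    Y sgp.  Hence M embeds in a projective module, and M -> M** is injective
    for all sgp M, in particular for Y; a diagram chase then gives that M -> M**
    is surjective ([sgp_torsionless], [sgp_ev_surjective]).  The dual sequence
    0 -> Y* -> P* -> Z* -> 0 is exact, and the surjectivity of Y -> Y** says
    that maps Y* -> A extend to P*, that is Ext^1(Z*, A) = 0.  So M* is a
    summand of a module Z* with vanishing Ext^1 whose syzygy Y* is again the
    dual of an sgp module; iterating, M* is sgp ([sgp_dual]).  Finally a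
    transpose T of M lies in exact sequences 0 -> M* -> P0* -> W -> 0 and
    0 -> W -> P1* -> T -> 0 along which maps to A extend, again by reflexivity
    of M, so T is sgp ([sgp_transpose]).

    The bridge between Ext, which is defined by all projective resolutions, and
    these one-step arguments is [sgp_coinduction]: a class of modules closed
    under taking one well-chosen syzygy, with the extension property, up to
    stable retracts, consists of sgp modules.  The chosen syzygies need not be
    those of a given resolution, and [stable_retract_syzygy] compares them. *)

Set Implicit Arguments.
Unset Strict Implicit.
Unset Printing Implicit Defensive.

Import GRing.Theory.
Local Open Scope ring_scope.

(** * Homomorphisms, exact sequences and submodules *)

Section Homs.
Variables (K : fieldType) (A : falgType K).
Implicit Types B L M N P Q R X Y Z : rmod A.

Lemma actDl M (x y : M) (a : A) : act (x + y) a = act x a + act y a.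
Proof. by have := act_linearl a 1 x y; rewrite !scale1r. Qed.

Lemma act0l M (a : A) : act (0 : M) a = 0.
Proof. by apply: (addrI (act (0 : M) a)); rewrite -actDl !addr0. Qed.

Lemma actZl M (k : K) (x : M) (a : A) : act (k *: x) a = k *: act x a.
Proof. by have := act_linearl a k x 0; rewrite !addr0 act0l addr0. Qed.

Lemma actBl M (x y : M) (a : A) : act (x - y) a = act x a - act y a.
Proof. by rewrite actDl -scaleN1r actZl scaleN1r. Qed.

Lemma act_suml M n (F : 'I_n -> M) (a : A) :
  act (\sum_j F j) a = \sum_j act (F j) a.
Proof.
apply: (big_morph (fun x : M => act x a)) => [x y|]; first exact: actDl.
exact: act0l.
Qed.

Lemma actDr M (x : M) (a b : A) : act x (a + b) = act x a + act x b.
Proof. by have := act_linearr x 1 a b; rewrite !scale1r. Qed.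

Lemma act0r M (x : M) : act x 0 = 0.
Proof. by apply: (addrI (act x 0)); rewrite -actDr !addr0. Qed.

Lemma actZr M (k : K) (x : M) (a : A) : act x (k *: a) = k *: act x a.
Proof. by have := act_linearr x k a 0; rewrite !addr0 act0r addr0. Qed.

Lemma linfun_ext (U V : vectType K) (f : U -> V) : linear f -> linfun f =1 f.
Proof.
move=> lf; exact: (lfunE (HB.pack f (GRing.isLinear.Build K U V _ _ lf)
  : {linear U -> V})).
Qed.

Lemma hom_of_fun M N (f : M -> N) :
    linear f -> (forall x a, f (act x a) = act (f x) a) ->
  exists2 h : 'Hom(M, N), is_hom h & h =1 f.
Proof.
move=> lf fA; have E := linfun_ext lf.
by exists (linfun f) => // x a; rewrite !E.
Qed.

Lemma is_hom_comp L M N (f : 'Hom(L, M)) (g : 'Hom(M, N)) :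
  is_hom f -> is_hom g -> is_hom (g \o f)%VF.
Proof. by move=> fA gA x a; rewrite !comp_lfunE fA gA. Qed.

Lemma is_hom_id M : is_hom (\1%VF : 'Hom(M, M)).
Proof. by move=> x a; rewrite !id_lfunE. Qed.

Lemma is_homD M N (f g : 'Hom(M, N)) : is_hom f -> is_hom g -> is_hom (f + g).
Proof. by move=> fA gA x a; rewrite !add_lfunE fA gA actDl. Qed.

Lemma sub_lfunE (U V : vectType K) (f g : 'Hom(U, V)) x :
  (f - g)%R x = f x - g x.
Proof. by rewrite add_lfunE opp_lfunE. Qed.

Lemma is_homB M N (f g : 'Hom(M, N)) : is_hom f -> is_hom g -> is_hom (f - g).
Proof. by move=> fA gA x a; rewrite !sub_lfunE fA gA actBl. Qed.

Lemma surjectiveP M N (f : 'Hom(M, N)) :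
  surjective f <-> forall y, exists x, f x = y.
Proof.
split=> [sf y | sf].
  have : y \in limg f by rewrite sf memvf.
  by case/memv_imgP=> x _ ->; exists x.
apply/eqP; rewrite eqEsubv subvf /=; apply/subvP=> y _.
by have [x <-] := sf y; rewrite memv_img ?memvf.
Qed.

Lemma hom_factor_surj P M N (p : 'Hom(P, M)) (f : 'Hom(P, N)) :
    is_hom p -> (forall y, exists x, p x = y) -> is_hom f ->
    (forall x, p x = 0 -> f x = 0) ->
  exists2 h : 'Hom(M, N), is_hom h & forall x, h (p x) = f x.
Proof.
move=> pA psurj fA kpf; have hp x : (f \o p^-1)%VF (p x) = f x.
  rewrite comp_lfunE; apply/eqP; rewrite -subr_eq0 -linearB; apply/eqP/kpf.
  by rewrite linearB /= limg_lfunVK ?subrr // memv_img ?memvf.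
exists (f \o p^-1)%VF => // y a.
by have [x <-] := psurj y; rewrite -pA !hp fA.
Qed.

(** A linear section of i on its image is chosen arbitrarily outside the image;
    this is harmless since f takes its values in the image. *)
Lemma hom_factor_inj X P N (i : 'Hom(X, P)) (f : 'Hom(N, P)) :
    is_hom i -> injective i -> is_hom f ->
    (forall x, exists z, i z = f x) ->
  exists2 h : 'Hom(N, X), is_hom h & forall x, i (h x) = f x.
Proof.
move=> iA iinj fA fi; have hi x : i ((i^-1 \o f)%VF x) = f x.
  rewrite comp_lfunE limg_lfunVK //.
  by have [z <-] := fi x; rewrite memv_img ?memvf.
exists (i^-1 \o f)%VF => // x a.
by apply: iinj; rewrite iA !hi fA.
Qed.

Lemma proj_lift P M N (g : 'Hom(M, N)) (f : 'Hom(P, N)) :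
    projective P -> is_hom g -> (forall y, exists x, g x = y) -> is_hom f ->
  exists2 h : 'Hom(P, M), is_hom h & forall x, g (h x) = f x.
Proof.
move=> Pp gA gs fA; have [h [hA gh]] := Pp _ _ _ _ gA ((surjectiveP g).2 gs) fA.
by exists h => // x; rewrite -gh comp_lfunE.
Qed.

(** Exactness in terms of elements: the maps are chased on elements
    throughout, and [exactP] and [surjectiveP] translate to subspaces. *)
Definition short_exact X P M (i : 'Hom(X, P)) (p : 'Hom(P, M)) :=
  [/\ is_hom i, is_hom p, injective i, forall y, exists x, p x = y &
      forall x, p x = 0 <-> exists z, i z = x].

(** For X a syzygy of M inside a projective P, this is the vanishing of
    Ext^1(M, N). *)
Definition extends_along X P (i : 'Hom(X, P)) N :=
  forall f : 'Hom(X, N), is_hom f ->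
  exists2 h : 'Hom(P, N), is_hom h & forall x, h (i x) = f x.

Section Submodule.
Variables (M : rmod A) (U : {vspace M}) (subU : submodule U).

Definition submod_act (x : subvs_of U) (a : A) : subvs_of U :=
  Subvs (subU a (subvsP x)).

Fact submod_act_linearl a : linear (submod_act^~ a).
Proof. by move=> k x y; apply/val_inj; rewrite /= act_linearl. Qed.

Fact submod_act_linearr x : linear (submod_act x).
Proof. by move=> k a b; apply/val_inj; rewrite /= act_linearr. Qed.

Fact submod_act1 x : submod_act x 1 = x.
Proof. by apply/val_inj; rewrite /= act1. Qed.

Fact submod_actM x a b : submod_act x (a * b) = submod_act (submod_act x a) b.
Proof. by apply/val_inj; rewrite /= actM. Qed.

Definition submod : rmod A :=
  RMod submod_act_linearl submod_act_linearr submod_act1 submod_actM.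

Definition submod_incl : 'Hom(submod, M) := linfun vsval.

Lemma submod_inclE x : submod_incl x = vsval x.
Proof. by rewrite lfunE. Qed.

Lemma submod_incl_hom : is_hom submod_incl.
Proof. by move=> x a; rewrite !submod_inclE. Qed.

Lemma submod_incl_inj : injective submod_incl.
Proof. by move=> x y; rewrite !submod_inclE => /val_inj. Qed.

Lemma submod_inclP x : x \in U <-> exists z, submod_incl z = x.
Proof.
split=> [xU | [z <-]]; last by rewrite submod_inclE subvsP.
by exists (Subvs xU); rewrite submod_inclE.
Qed.

End Submodule.

Lemma submodule_ker M N (f : 'Hom(M, N)) : is_hom f -> submodule (lker f).
Proof. by move=> fA x a; rewrite !memv_ker fA => /eqP->; rewrite act0l. Qed.

Lemma submodule_img M N (f : 'Hom(M, N)) : is_hom f -> submodule (limg f).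
Proof.
by move=> fA _ a /memv_imgP[x _ ->]; rewrite -fA memv_img ?memvf.
Qed.

Lemma kernel_exact P M (p : 'Hom(P, M)) (pA : is_hom p) :
    (forall y, exists x, p x = y) ->
  short_exact (submod_incl (submodule_ker pA)) p.
Proof.
split=> //; [exact: submod_incl_hom | exact: submod_incl_inj |] => x.
by rewrite -submod_inclP memv_ker; split=> [->|/eqP].
Qed.

(** * Free modules and dual bases *)

Section Free.
Variable n : nat.

Definition free_act (v : {ffun 'I_n -> A}) (a : A) : {ffun 'I_n -> A} :=
  [ffun j => v j * a].

Fact free_act_linearl a : linear (free_act^~ a).
Proof. by move=> k x y; apply/ffunP=> j; rewrite !ffunE mulrDl -scalerAl. Qed.

Fact free_act_linearr x : linear (free_act x).
Proof. by move=> k a b; apply/ffunP=> j; rewrite !ffunE mulrDr -scalerAr. Qed.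

Fact free_act1 x : free_act x 1 = x.
Proof. by apply/ffunP=> j; rewrite !ffunE mulr1. Qed.

Fact free_actM x a b : free_act x (a * b) = free_act (free_act x a) b.
Proof. by apply/ffunP=> j; rewrite !ffunE mulrA. Qed.

Definition free_rmod : rmod A :=
  RMod free_act_linearl free_act_linearr free_act1 free_actM.

End Free.

(** Having a dual basis is equivalent to being projective, and it is a condition
    on finitely many elements and functionals.  All facts about the dual of a
    projective module are read off from it. *)
Definition has_dual_basis P n (b : 'I_n -> P)
    (phi : 'I_n -> 'Hom(P, regular_rmod A)) :=
  (forall j, is_hom (phi j)) /\ forall x, \sum_j act (b j) (phi j x) = x.

Lemma dual_basis_projective P n b phi :
  @has_dual_basis P n b phi -> projective P.
Proof.
move=> [phiA bphi] M N g f gA /surjectiveP gs fA.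
have [c cE] : exists c : 'I_n -> M, forall j, g (c j) = f (b j).
  exists (fun j => (g^-1)%VF (f (b j))) => j.
  by rewrite limg_lfunVK // ((surjectiveP g).2 gs) memvf.
have [||h hA hE] := @hom_of_fun P M (fun x => \sum_j act (c j) (phi j x)).
- move=> k x y; rewrite scaler_sumr -big_split; apply: eq_bigr => j _ /=.
  by rewrite linearP act_linearr.
- move=> x a; rewrite act_suml; apply: eq_bigr => j _.
  by rewrite phiA -actM.
exists h; split=> //; apply/lfunP=> x; rewrite comp_lfunE hE linear_sum.
rewrite -{2}[x]bphi linear_sum; apply: eq_bigr => j _ /=.
by rewrite gA cE fA.
Qed.

(** Push the elements forward along the retraction and pull the functionals
    back along the section. *)
Lemma dual_basis_retract P Q (h : 'Hom(P, Q)) (p : 'Hom(Q, P)) n b phi :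
    is_hom h -> is_hom p -> cancel h p -> @has_dual_basis Q n b phi ->
  has_dual_basis (fun j => p (b j)) (fun j => phi j \o h)%VF.
Proof.
move=> hA pA hK [phiA bphi]; split=> [j | x]; first exact: is_hom_comp.
rewrite -[RHS]hK -[h x in RHS]bphi linear_sum.
by apply: eq_bigr => j _ /=; rewrite comp_lfunE pA.
Qed.

Lemma free_dual_basis n : exists b phi, @has_dual_basis (free_rmod n) n b phi.
Proof.
pose phi j : 'Hom(free_rmod n, regular_rmod A) :=
  linfun (fun v : free_rmod n => v j : regular_rmod A).
have phiE j : phi j =1 (fun v => v j).
  by apply: linfun_ext => k x y; rewrite !ffunE.
pose e (j : 'I_n) : free_rmod n := [ffun i => (i == j)%:R].
exists e, phi; split=> [j x a | v]; first by rewrite !phiE /= ffunE.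
apply/ffunP=> i; rewrite sum_ffunE (bigD1 i) //= big1 ?addr0 => [|j ji].
  by rewrite !ffunE eqxx mul1r phiE.
by rewrite !ffunE eq_sym (negPf ji) mul0r.
Qed.

Lemma free_projective n : projective (free_rmod n).
Proof. by have [b [phi /dual_basis_projective]] := free_dual_basis n. Qed.

Definition free_cover M : 'Hom(free_rmod (\dim {:M}), M) :=
  linfun (fun v : free_rmod (\dim {:M}) =>
    \sum_(j < \dim {:M}) act (vbasis {:M})`_j (v j)).

Lemma free_coverE M (v : free_rmod (\dim {:M})) :
  free_cover M v = \sum_(j < \dim {:M}) act (vbasis {:M})`_j (v j).
Proof.
apply: linfun_ext => k x y.
rewrite scaler_sumr -big_split; apply: eq_bigr => j _ /=.
by rewrite !ffunE actDr actZr.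
Qed.

Lemma free_cover_hom M : is_hom (free_cover M).
Proof.
move=> x a; rewrite !free_coverE act_suml; apply: eq_bigr => j _.
by rewrite -actM ffunE.
Qed.

Lemma free_cover_surj M y : exists x, free_cover M x = y.
Proof.
exists (finfun (fun j => coord (vbasis {:M}) j y *: (1 : A))).
rewrite free_coverE {2}[y](coord_vbasis (memvf y)); apply: eq_bigr => j _.
by rewrite ffunE actZr act1.
Qed.

Lemma projective_dual_basis P : projective P ->
  exists n b phi, @has_dual_basis P n b phi.
Proof.
move=> Pp; have pA := @free_cover_hom P.
have [h hA ph] := proj_lift Pp pA (@free_cover_surj P) (@is_hom_id P).
have [b [phi bphi]] := free_dual_basis (\dim {:P}).
have hK : cancel h (free_cover P) by move=> x; rewrite ph id_lfunE.
by eexists _, _, _; apply: dual_basis_retract hA pA hK bphi.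
Qed.

(** The coordinates of a map into Q with respect to a dual basis are maps into
    A; they are extended one by one and recombined. *)
Lemma extends_along_projective X P (i : 'Hom(X, P)) Q :
  projective Q -> extends_along i (regular_rmod A) -> extends_along i Q.
Proof.
move=> /projective_dual_basis[n [b [phi [phiA bphi]]]] ext f fA.
have fin m (F : 'I_m -> 'Hom(X, regular_rmod A)) (c : 'I_m -> Q) :
    (forall j, is_hom (F j)) ->
  exists2 h : 'Hom(P, Q), is_hom h &
    forall x, h (i x) = \sum_j act (c j) (F j x).
  elim: m F c => [|m IHm] F c FA.
    exists 0 => [x a | x]; first by rewrite !zero_lfunE act0l.
    by rewrite big_ord0 zero_lfunE.
  have [h hA hE] := IHm (F \o lift ord0) (c \o lift ord0) (fun j => FA _).
  have [g gA gE] := ext _ (FA ord0).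
  have [|x a|k kA kE] := @hom_of_fun P Q (fun x => act (c ord0) (g x)).
  - by move=> k x y; rewrite linearP act_linearr.
  - by rewrite gA -actM.
  exists (k + h) => [|x]; first exact: is_homD.
  by rewrite add_lfunE kE gE hE big_ord_recl.
have [h hA hE] := fin _ _ b (fun j => is_hom_comp fA (phiA j)).
exists h => // x; rewrite hE -[RHS]bphi.
by apply: eq_bigr => j _; rewrite comp_lfunE.
Qed.

(** * Direct sums *)

Section SumMaps.
Variables M N : rmod A.

Definition dsum_fst : 'Hom(dsum M N, M) := linfun (fun x : dsum M N => x.1).
Definition dsum_snd : 'Hom(dsum M N, N) := linfun (fun x : dsum M N => x.2).
Definition dsum_inl : 'Hom(M, dsum M N) :=
  linfun (fun x : M => (x, 0) : dsum M N).
Definition dsum_inr : 'Hom(N, dsum M N) :=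
  linfun (fun y : N => (0, y) : dsum M N).

Lemma dsum_fstE x : dsum_fst x = x.1.
Proof. by rewrite linfun_ext. Qed.

Lemma dsum_sndE x : dsum_snd x = x.2.
Proof. by rewrite linfun_ext. Qed.

Lemma dsum_inlE x : dsum_inl x = (x, 0).
Proof.
rewrite linfun_ext // => k y z; congr pair => /=.
by rewrite scaler0 addr0.
Qed.

Lemma dsum_inrE x : dsum_inr x = (0, x).
Proof.
rewrite linfun_ext // => k y z; congr pair => /=.
by rewrite scaler0 addr0.
Qed.

Lemma dsum_fst_hom : is_hom dsum_fst.
Proof. by move=> x a; rewrite !dsum_fstE. Qed.

Lemma dsum_snd_hom : is_hom dsum_snd.
Proof. by move=> x a; rewrite !dsum_sndE. Qed.

Lemma dsum_inl_hom : is_hom dsum_inl.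
Proof. by move=> x a; rewrite !dsum_inlE /= /dsum_act /= act0l. Qed.

Lemma dsum_inr_hom : is_hom dsum_inr.
Proof. by move=> x a; rewrite !dsum_inrE /= /dsum_act /= act0l. Qed.

End SumMaps.

Lemma hom_pair L M N (f : 'Hom(L, M)) (g : 'Hom(L, N)) :
    is_hom f -> is_hom g ->
  exists2 h : 'Hom(L, dsum M N), is_hom h & forall x, h x = (f x, g x).
Proof.
move=> fA gA; apply: hom_of_fun => [k x y | x a]; first by rewrite !linearP.
by rewrite fA gA.
Qed.

Lemma hom_copair L M N (f : 'Hom(M, L)) (g : 'Hom(N, L)) :
    is_hom f -> is_hom g ->
  exists2 h : 'Hom(dsum M N, L), is_hom h & forall x, h x = f x.1 + g x.2.
Proof.
move=> fA gA; apply: hom_of_fun => [k x y | x a].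
  by rewrite !linearP scalerDr addrACA.
by rewrite /= fA gA actDl.
Qed.

Lemma hom_map_dsum M N M' N' (f : 'Hom(M, M')) (g : 'Hom(N, N')) :
    is_hom f -> is_hom g ->
  exists2 h : 'Hom(dsum M N, dsum M' N'), is_hom h &
    forall x, h x = (f x.1, g x.2).
Proof.
move=> fA gA; apply: hom_of_fun => [k x y | x a]; first by rewrite !linearP.
by rewrite /= /dsum_act fA gA.
Qed.

Lemma projective_dsum P Q :
  projective P -> projective Q -> projective (dsum P Q).
Proof.
move=> Pp Qp M N g f gA gs fA.
have [h [hA gh]] := Pp _ _ _ _ gA gs (is_hom_comp (@dsum_inl_hom P Q) fA).
have [k [kA gk]] := Qp _ _ _ _ gA gs (is_hom_comp (@dsum_inr_hom P Q) fA).
have [l lA lE] := hom_copair hA kA.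
exists l; split=> //; apply/lfunP=> -[x y]; rewrite comp_lfunE lE linearD.
have /lfunP/(_ x) := gh; have /lfunP/(_ y) := gk.
rewrite !comp_lfunE dsum_inrE dsum_inlE /= => -> ->; rewrite -linearD.
by congr (f (_, _)); rewrite /= ?addr0 ?add0r.
Qed.

Lemma short_exact_dsum X P M X' P' M' (i : 'Hom(X, P)) (p : 'Hom(P, M))
    (i' : 'Hom(X', P')) (p' : 'Hom(P', M')) :
    short_exact i p -> short_exact i' p' ->
  exists (j : 'Hom(dsum X X', dsum P P')) (q : 'Hom(dsum P P', dsum M M')),
    short_exact j q /\ forall x, j x = (i x.1, i' x.2).
Proof.
move=> [iA pA iI pS ip] [iA' pA' iI' pS' ip'].
have [j jA jE] := hom_map_dsum iA iA'.
have [q qA qE] := hom_map_dsum pA pA'.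
exists j, q; split=> //; split=> //.
- by move=> [x x'] [y y']; rewrite !jE /= => -[/iI-> /iI'->].
- move=> [y y']; have [x <-] := pS y; have [x' <-] := pS' y'.
  by exists (x, x'); rewrite qE.
move=> [x x']; rewrite qE; split=> /=.
  by case=> /ip[z <-] /ip'[z' <-]; exists (z, z'); rewrite jE.
case=> [[z z']]; rewrite jE => -[<- <-]; congr pair.
  by apply/ip; exists z.
by apply/ip'; exists z'.
Qed.

(** * Stable retracts *)

(** The module M is a direct summand of N up to projective summands.  In
    contrast to the relation of being isomorphic up to projective summands, this
    passes to syzygies without choosing minimal projective covers. *)
Definition stable_retract M N :=
  exists Q (u : 'Hom(M, N)) (v : 'Hom(N, M)) (s : 'Hom(M, Q)) (t : 'Hom(Q, M)),
  [/\ projective Q, is_hom u /\ is_hom v, is_hom s /\ is_hom t &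
      forall x, v (u x) + t (s x) = x].

Lemma stable_retract_refl M : stable_retract M M.
Proof.
exists (free_rmod 0), \1%VF, \1%VF, 0, 0; split=> [||| x].
- exact: free_projective.
- by split; apply: is_hom_id.
- by split=> x a; rewrite !zero_lfunE act0l.
- by rewrite !id_lfunE zero_lfunE addr0.
Qed.

Lemma retract_stable M N (u : 'Hom(M, N)) (v : 'Hom(N, M)) :
    is_hom u -> is_hom v -> (forall x, v (u x) = x) -> stable_retract M N.
Proof.
move=> uA vA vu; exists (free_rmod 0), u, v, 0, 0; split=> // [|| x].
- exact: free_projective.
- by split=> x a; rewrite !zero_lfunE act0l.
- by rewrite vu zero_lfunE addr0.
Qed.

Lemma zero_stable_retract M N : zero_module M -> stable_retract M N.
Proof.
by move=> M0; apply: (@retract_stable _ _ 0 0) => x *;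
  rewrite ?zero_lfunE ?act0l //.
Qed.

Lemma stable_retract_trans L M N :
  stable_retract L M -> stable_retract M N -> stable_retract L N.
Proof.
move=> [Q [u [v [s [t [Qp [uA vA] [sA tA] E]]]]]].
move=> [Q' [u' [v' [s' [t' [Qp' [uA' vA'] [sA' tA'] E']]]]]].
have [a aA aE] := hom_pair sA (is_hom_comp uA sA').
have [b bA bE] := hom_copair tA (is_hom_comp tA' vA).
exists (dsum Q Q'), (u' \o u)%VF, (v \o v')%VF, a, b; split.
- exact: projective_dsum.
- by split; apply: is_hom_comp.
- by [].
move=> x; rewrite aE bE !comp_lfunE /= [t _ + _]addrC.
by rewrite addrA -linearD E' E.
Qed.

Lemma stable_retract_dsum M N M' N' :
  stable_retract M N -> stable_retract M' N' ->
  stable_retract (dsum M M') (dsum N N').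
Proof.
move=> [Q [u [v [s [t [Qp [uA vA] [sA tA] E]]]]]].
move=> [Q' [u' [v' [s' [t' [Qp' [uA' vA'] [sA' tA'] E']]]]]].
have [a aA aE] := hom_map_dsum uA uA'.
have [b bA bE] := hom_map_dsum vA vA'.
have [c cA cE] := hom_map_dsum sA sA'.
have [d dA dE] := hom_map_dsum tA tA'.
exists (dsum Q Q'), a, b, c, d; split=> //; first exact: projective_dsum.
by case=> x x'; rewrite aE bE cE dE; congr pair; rewrite /= ?E ?E'.
Qed.

(** Lift u and v to U and V between the projectives and restrict them to the
    syzygies as u' and v'.  The map 1 - VU - T s p, where T lifts t, takes P
    into X, say as r; on X it is 1 - v' u', so the identity of X is v' u' + r i,
    with r i factoring through P.  Applied with M = N, this says that syzygies
    and the extension property are independent of the chosen surjection from a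
    projective. *)
Lemma stable_retract_syzygy M N X P Y R (i : 'Hom(X, P)) (p : 'Hom(P, M))
    (j : 'Hom(Y, R)) (q : 'Hom(R, N)) :
    projective P -> projective R -> short_exact i p -> short_exact j q ->
    stable_retract M N ->
  stable_retract X Y /\ forall B, extends_along j B -> extends_along i B.
Proof.
move=> Pp Rp [iA pA iI pS ip] [jA qA jI qS jq].
move=> [Q [u [v [s [t [Qp [uA vA] [sA tA] E]]]]]].
have pi z : p (i z) = 0 by apply/ip; exists z.
have qj z : q (j z) = 0 by apply/jq; exists z.
have [U UA UE] := proj_lift Pp qA qS (is_hom_comp pA uA).
have [V VA VE] := proj_lift Rp pA pS (is_hom_comp qA vA).
have [T TA TE] := proj_lift Qp pA pS tA.
have [|x|u' uA' uE'] :=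
  hom_factor_inj (f := (U \o i)%VF) jA jI; first exact: is_hom_comp.
  by apply/jq; rewrite !comp_lfunE UE comp_lfunE pi linear0.
have [|x|v' vA' vE'] :=
  hom_factor_inj (f := (V \o j)%VF) iA iI; first exact: is_hom_comp.
  by apply/ip; rewrite !comp_lfunE VE comp_lfunE qj linear0.
have VUA := is_hom_comp UA VA.
have TsA := is_hom_comp (is_hom_comp pA sA) TA.
have [|x|r rA rE] :=
  hom_factor_inj (f := \1%VF - (V \o U)%VF - (T \o (s \o p))%VF) iA iI.
- by apply: is_homB (is_homB (@is_hom_id _) VUA) _.
- apply/ip; rewrite !(sub_lfunE, comp_lfunE, id_lfunE) !linearB /= VE TE.
  by rewrite comp_lfunE UE comp_lfunE -addrA -opprD E subrr.
have Er x : v' (u' x) + r (i x) = x.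
  apply: iI; rewrite linearD /= vE' rE !(sub_lfunE, comp_lfunE, id_lfunE) uE'.
  by rewrite comp_lfunE pi (linear0 s) (linear0 T) subr0 addrC subrK.
split; first by exists P, u', v', i, r.
move=> B ext f fA.
have [h hA hE] := ext _ (is_hom_comp vA' fA).
exists ((h \o U)%VF + (f \o r)%VF) => [|x].
  by apply: is_homD; apply: is_hom_comp.
rewrite add_lfunE !comp_lfunE -[RHS](congr1 f (Er x)) linearD /=.
by rewrite -[U (i x)]comp_lfunE -uE' hE comp_lfunE.
Qed.

(** Converse of the previous lemma under the vanishing of Ext^1 into A: instead
    of lifting from the quotients, extend u, v and s from the syzygies to the
    projectives.  Then 1 - VU - i t S kills X, hence factors through M, and its
    composite with p shows that 1 - v' u' factors through P. *)
Lemma stable_retract_cosyzygy M N X P Y R (i : 'Hom(X, P)) (p : 'Hom(P, M))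
    (j : 'Hom(Y, R)) (q : 'Hom(R, N)) :
    projective P -> projective R -> short_exact i p -> short_exact j q ->
    extends_along i (regular_rmod A) -> extends_along j (regular_rmod A) ->
    stable_retract X Y ->
  stable_retract M N.
Proof.
move=> Pp Rp [iA pA iI pS ip] [jA qA jI qS jq] exti extj.
move=> [Q [u [v [s [t [Qp [uA vA] [sA tA] E]]]]]].
have pi z : p (i z) = 0 by apply/ip; exists z.
have qj z : q (j z) = 0 by apply/jq; exists z.
have [U UA UE] := extends_along_projective Rp exti (is_hom_comp uA jA).
have [V VA VE] := extends_along_projective Pp extj (is_hom_comp vA iA).
have [S SA SE] := extends_along_projective Qp exti sA.
have [|x|u' uA' uE'] :=
  hom_factor_surj (f := (q \o U)%VF) pA pS; first exact: is_hom_comp.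
  by case/ip=> z <-; rewrite comp_lfunE UE comp_lfunE qj.
have [|x|v' vA' vE'] :=
  hom_factor_surj (f := (p \o V)%VF) qA qS; first exact: is_hom_comp.
  by case/jq=> z <-; rewrite comp_lfunE VE comp_lfunE pi.
have itSA := is_hom_comp SA (is_hom_comp tA iA).
have VUA := is_hom_comp UA VA.
have [|x|r rA rE] :=
  hom_factor_surj (f := \1%VF - (V \o U)%VF - ((i \o t) \o S)%VF) pA pS.
- by apply: is_homB (is_homB (@is_hom_id _) VUA) _.
- case/ip=> z <-; rewrite !(sub_lfunE, comp_lfunE, id_lfunE) UE comp_lfunE VE.
  by rewrite SE comp_lfunE -addrA -opprD -linearD E subrr.
exists P, u', v', r, p; split=> // y; have [x <-] := pS y.
rewrite uE' comp_lfunE vE' rE !(sub_lfunE, comp_lfunE, id_lfunE) -linearD.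
by rewrite addrA subrKC linearB /= pi subr0.
Qed.

End Homs.

(** * Projective resolutions and vanishing of Ext *)

Section Resolutions.
Variables (K : fieldType) (A : falgType K).
Implicit Types B L M N P Q R X Y Z : rmod A.
Local Notation A_A := (regular_rmod A).

Lemma exactP X P M (f : 'Hom(X, P)) (g : 'Hom(P, M)) :
  limg f = lker g <-> forall x, g x = 0 <-> exists z, f z = x.
Proof.
split=> [E x | E].
  have -> : (g x = 0) <-> x \in limg f.
    by rewrite E memv_ker; split=> [->|/eqP].
  by split=> [/memv_imgP[z _ ->]|[z <-]]; [exists z | rewrite memv_img ?memvf].
apply/vspaceP=> x; rewrite memv_ker; apply/idP/eqP.
  by case/memv_imgP=> z _ ->; apply/E; exists z.
by case/E=> z <-; rewrite memv_img ?memvf.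
Qed.

Section Splice.
Variables (X P M : rmod A) (i : 'Hom(X, P)) (p : 'Hom(P, M)).
Hypotheses (Pp : projective P) (ip : short_exact i p).
Variable R : proj_resolution X.

Definition splice_obj k : rmod A := if k is l.+1 then R l else P.

Definition splice_diff k : 'Hom(splice_obj k.+1, splice_obj k) :=
  match k return 'Hom(splice_obj k.+1, splice_obj k) with
  | 0 => (i \o pr_aug R)%VF
  | l.+1 => pr_diff R l
  end.

Fact splice_projective k : projective (splice_obj k).
Proof. by case: k => //= l; apply: pr_projective. Qed.

Fact splice_diff_hom k : is_hom (splice_diff k).
Proof.
case: k => [|l]; last exact: pr_diff_hom.
by case: ip => iA *; apply: is_hom_comp => //; apply: pr_aug_hom.
Qed.

Fact splice_aug_hom : is_hom p.
Proof. by case: ip. Qed.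

Fact splice_aug_surj : surjective p.
Proof. by apply/surjectiveP; case: ip. Qed.

Fact splice_exact0 : limg (splice_diff 0) = lker p.
Proof.
apply/exactP=> x; case: ip => _ _ _ _ ->.
split=> -[z <-]; last by rewrite comp_lfunE; exists (pr_aug R z).
have [y <-] := (surjectiveP _).1 (@pr_aug_surj _ _ _ R) z.
by exists y; rewrite comp_lfunE.
Qed.

Fact splice_exactS k : limg (splice_diff k.+1) = lker (splice_diff k).
Proof.
case: k => [|l]; last exact: pr_exactS.
rewrite [LHS]/= pr_exact0; apply/vspaceP=> x; rewrite !memv_ker comp_lfunE.
have i_inj : injective i by case: ip.
by rewrite -(inj_eq i_inj) linear0.
Qed.

Definition splice : proj_resolution M :=
  ProjResolution splice_projective splice_diff_hom splice_aug_hom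
    splice_aug_surj splice_exact0 splice_exactS.

End Splice.

Definition free_syzygy M := submod (submodule_ker (@free_cover_hom _ _ M)).

Definition free_syzygy_incl M : 'Hom(free_syzygy M, free_rmod A (\dim {:M})) :=
  submod_incl (submodule_ker (@free_cover_hom _ _ M)).

Lemma free_syzygy_exact M : short_exact (free_syzygy_incl M) (free_cover M).
Proof. exact: kernel_exact (@free_cover_surj _ _ M). Qed.

Section FreeResolution.
Variable M : rmod A.
Let S k := iter k free_syzygy M.

Definition free_res_diff k : 'Hom(free_rmod A (\dim {:S k.+1}),
    free_rmod A (\dim {:S k})) :=
  (free_syzygy_incl (S k) \o free_cover (S k.+1))%VF.

Fact free_res_diff_hom k : is_hom (free_res_diff k).
Proof.
apply: is_hom_comp; first exact: free_cover_hom.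
by case: (free_syzygy_exact (S k)).
Qed.

Fact free_res_exact0 : limg (free_res_diff 0) = lker (free_cover M).
Proof.
apply/exactP=> x; case: (free_syzygy_exact M) => _ _ _ _ ->.
split=> -[z <-]; last by rewrite comp_lfunE; exists (free_cover (S 1) z).
by have [y <-] := free_cover_surj z; exists y; rewrite comp_lfunE.
Qed.

Fact free_res_exactS k : limg (free_res_diff k.+1) = lker (free_res_diff k).
Proof.
apply/exactP=> x; rewrite comp_lfunE.
have [_ _ inj _ _] := free_syzygy_exact (S k).
have -> : free_syzygy_incl (S k) (free_cover (S k.+1) x) = 0 <->
    free_cover (S k.+1) x = 0.
  by split=> [E | ->]; [apply: inj; rewrite E|]; rewrite linear0.
case: (free_syzygy_exact (S k.+1)) => _ _ _ _ ->.
split=> -[z <-]; last by rewrite comp_lfunE; exists (free_cover (S k.+2) z).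
by have [y <-] := free_cover_surj z; exists y; rewrite comp_lfunE.
Qed.

Definition free_resolution : proj_resolution M :=
  ProjResolution (fun k => @free_projective _ _ (\dim {:S k})) free_res_diff_hom
    (@free_cover_hom _ _ M) ((surjectiveP _).2 (@free_cover_surj _ _ M))
    free_res_exact0 free_res_exactS.

End FreeResolution.

Local Notation sgp := (@semi_Gorenstein_projective K A).

(** Splicing a resolution of X with the sequence gives a resolution of M, in
    which cocycles and coboundaries of degree k + 1 are literally those of
    degree k for X. *)
Lemma sgp_syzygy X P M (i : 'Hom(X, P)) (p : 'Hom(P, M)) :
  projective P -> short_exact i p -> sgp M -> sgp X.
Proof.
move=> Pp ip Msgp [//|k] _ R f [fA fd].
exact: (Msgp k.+2 isT (splice Pp ip R) f (conj fA fd)).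
Qed.

(** A map X -> A is a 1-cocycle on a spliced resolution of M, and a 0-cochain
    with this coboundary is an extension to P. *)
Lemma sgp_extends X P M (i : 'Hom(X, P)) (p : 'Hom(P, M)) :
  projective P -> short_exact i p -> sgp M -> extends_along i A_A.
Proof.
move=> Pp ip Msgp f fA; move: (free_resolution X) => R.
have augd x : pr_aug R (pr_diff R 0 x) = 0.
  by apply/(exactP (pr_diff R 0) (pr_aug R)).1; [exact: pr_exact0 | exists x].
have fc : @cocycle _ _ _ _ R 0 (f \o pr_aug R)%VF.
  split; first exact: is_hom_comp (@pr_aug_hom _ _ _ R) fA.
  by apply/lfunP=> x; rewrite !comp_lfunE zero_lfunE augd linear0.
have [h [hA hE]] := Msgp 1%N isT (splice Pp ip R) _ fc.
exists h => // x.
have [y <-] := (surjectiveP _).1 (@pr_aug_surj _ _ _ R) x.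
by have /lfunP/(_ y) := hE; rewrite !comp_lfunE.
Qed.

Lemma sgp_free_syzygy M : sgp M ->
  extends_along (free_syzygy_incl M) A_A /\ sgp (free_syzygy M).
Proof.
move=> Msgp; have Fp := @free_projective _ A (\dim {:M}).
have ip := free_syzygy_exact M.
by split; [apply: sgp_extends Fp ip Msgp | apply: sgp_syzygy Fp ip Msgp].
Qed.

(** Dropping the first term of a resolution of M gives one of the kernel X of
    the augmentation, with the same cocycles one degree lower. *)
Lemma truncate_resolution M (P : proj_resolution M) :
  exists X (j : 'Hom(X, P 0%N)) (e : 'Hom(P 1%N, X)) (R : proj_resolution X),
  [/\ short_exact j (pr_aug P), is_hom e /\ forall y, exists x, e x = y,
      forall x, j (e x) = pr_diff P 0 x &
      forall k N, (forall f : 'Hom(R k.+1, N), cocycle f -> coboundary f) ->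
        forall f : 'Hom(P k.+2, N), cocycle f -> coboundary f].
Proof.
pose augA := @pr_aug_hom _ _ _ P; pose X := submod (submodule_ker augA).
have je : short_exact (submod_incl (submodule_ker augA)) (pr_aug P).
  by apply: kernel_exact; apply/surjectiveP/pr_aug_surj.
have [jA _ jI _ jP] := je.
have dP := (exactP _ _).1 (@pr_exact0 _ _ _ P).
have [|x|e eA eE] := hom_factor_inj (f := pr_diff P 0) jA jI.
- exact: pr_diff_hom.
- by apply/jP/dP; exists x.
have eS y : exists x, e x = y.
  have /dP[x xE] : pr_aug P (submod_incl (submodule_ker augA) y) = 0.
    by apply/jP; exists y.
  by exists x; apply: jI; rewrite eE.
have ex0 : limg (pr_diff P 1) = lker e.
  rewrite pr_exactS; apply/vspaceP=> x; rewrite !memv_ker -eE.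
  by rewrite -(inj_eq jI) linear0.
pose R := @ProjResolution _ _ X (fun k => P k.+1) (fun k => pr_diff P k.+1) e
  (fun k => @pr_projective _ _ _ P k.+1) (fun k => @pr_diff_hom _ _ _ P k.+1)
  eA ((surjectiveP _).2 eS) ex0 (fun k => @pr_exactS _ _ _ P k.+1).
exists X, (submod_incl (submodule_ker augA)), e, R; split=> //.
Qed.

(** By induction on the degree: given any resolution P of M, the kernel of its
    augmentation is a stable retract of the syzygy X provided by the class, and
    inherits the extension property.  In degree 1 the extension property bounds
    the cocycle; higher degrees reduce to the truncated resolution.  The module
    Z makes it enough to control syzygies up to stable retracts. *)
Lemma sgp_coinduction (C : rmod A -> Prop) :
    (forall N, C N -> exists Z X P (i : 'Hom(X, P)) (p : 'Hom(P, Z)),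
      [/\ stable_retract N Z, projective P, short_exact i p,
          extends_along i A_A & C X]) ->
  forall M N, stable_retract M N -> C N -> sgp M.
Proof.
move=> Cstep M N MN CN [//|k] _.
elim: k M N MN CN => [|k IHk] M N MN CN P.
all: have [Z [X [Q [i [p [NZ Qp ip exti CX]]]]]] := Cstep N CN.
all: have [Y [j [e [R [jP [eA eS] eE step]]]]] := truncate_resolution P.
all: have [YX extj] := stable_retract_syzygy (@pr_projective _ _ _ P 0) Qp jP ip
  (stable_retract_trans MN NZ).
  move=> f [fA fd].
  have [|g gA gE] := hom_factor_surj eA eS fA.
    move=> x ex0; have := congr1 (fun y => j y) ex0; rewrite eE linear0.
    move/((exactP _ _).1 (@pr_exactS _ _ _ P 0)) => [y <-].
    by have /lfunP/(_ y) := fd; rewrite comp_lfunE zero_lfunE.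
  have [h hA hE] := extj _ exti g gA.
  exists h; split=> //; apply/lfunP=> x.
  by rewrite comp_lfunE -eE hE gE.
exact/step/(IHk _ _ YX CX R).
Qed.

Lemma sgp_stable_retract M N : stable_retract M N -> sgp N -> sgp M.
Proof.
apply: sgp_coinduction => X /sgp_free_syzygy[extX Ysgp].
exists X, (free_syzygy X), _, (free_syzygy_incl X), (free_cover X).
split=> //; first exact: stable_retract_refl.
  exact: free_projective.
exact: free_syzygy_exact.
Qed.

Lemma sgp_of_syzygy X P M (i : 'Hom(X, P)) (p : 'Hom(P, M)) :
  projective P -> short_exact i p -> extends_along i A_A -> sgp X -> sgp M.
Proof.
move=> Pp ip exti Xsgp.
apply: (sgp_coinduction (C := fun N => sgp N \/ N = M) _
  (stable_retract_refl M)); last by right.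
move=> N [/sgp_free_syzygy[extN Ysgp] | ->]; last first.
  by exists M, X, P, i, p; split=> //; [exact: stable_retract_refl | left].
exists N, (free_syzygy N), _, (free_syzygy_incl N), (free_cover N).
split=> //; last by left.
- exact: stable_retract_refl.
- exact: free_projective.
exact: free_syzygy_exact.
Qed.

Lemma extends_along_dsum X P X' P' N (i : 'Hom(X, P)) (i' : 'Hom(X', P'))
    (j : 'Hom(dsum X X', dsum P P')) :
    (forall x, j x = (i x.1, i' x.2)) ->
    extends_along i N -> extends_along i' N ->
  extends_along j N.
Proof.
move=> jE ext ext' f fA.
have [h hA hE] := ext _ (is_hom_comp (@dsum_inl_hom _ _ X X') fA).
have [h' hA' hE'] := ext' _ (is_hom_comp (@dsum_inr_hom _ _ X X') fA).
have [l lA lE] := hom_copair hA hA'.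
exists l => // -[x x']; rewrite lE jE hE hE' !comp_lfunE dsum_inlE dsum_inrE.
by rewrite -linearD; congr (f (_, _)); rewrite /= ?addr0 ?add0r.
Qed.

Lemma sgp_dsum M N : sgp M -> sgp N -> sgp (dsum M N).
Proof.
move=> Msgp Nsgp.
apply: (sgp_coinduction
  (C := fun L => exists M N, [/\ sgp M, sgp N & L = dsum M N]) _
  (stable_retract_refl _)); last by exists M, N.
move=> _ [{Msgp}M [{Nsgp}N [Msgp Nsgp ->]]].
have [extM M'sgp] := sgp_free_syzygy Msgp.
have [extN N'sgp] := sgp_free_syzygy Nsgp.
have [j [q [jq jE]]] :=
  short_exact_dsum (free_syzygy_exact M) (free_syzygy_exact N).
exists (dsum M N), (dsum (free_syzygy M) (free_syzygy N)), _, j, q; split=> //.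
- exact: stable_retract_refl.
- by apply: projective_dsum; apply: free_projective.
- exact: extends_along_dsum jE extM extN.
by exists (free_syzygy M), (free_syzygy N).
Qed.

End Resolutions.

(** * Indecomposable summands and minimal syzygies *)

Section Finiteness.
Variables (K : fieldType) (A : falgType K).
Implicit Types B L M N P Q R X Y Z : rmod A.
Local Notation A_A := (regular_rmod A).
Local Notation sgp := (@semi_Gorenstein_projective K A).

Lemma iso_inverse M N : iso M N ->
  exists (f : 'Hom(M, N)) (g : 'Hom(N, M)),
    [/\ is_hom f, is_hom g, cancel f g & cancel g f].
Proof.
move=> [f [fA f_bij]]; have [g fK gK] := f_bij.
have [|x|h hA hE] := hom_factor_inj (f := \1%VF) fA (bij_inj f_bij).
- exact: is_hom_id.
- by exists (g x); rewrite gK id_lfunE.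
have hK : cancel h f by move=> x; rewrite hE id_lfunE.
by exists f, h; split=> // x; apply: (bij_inj f_bij); rewrite hK.
Qed.

Lemma iso_stable_retract M N :
  iso M N -> stable_retract M N /\ stable_retract N M.
Proof.
case/iso_inverse=> f [g [fA gA fK gK]].
by split; [apply: (retract_stable fA gA fK) | apply: (retract_stable gA fA gK)].
Qed.

Lemma iso_dsum_maps M X Y : iso M (dsum X Y) ->
  exists (a : 'Hom(M, X)) (a' : 'Hom(X, M)) (b : 'Hom(M, Y)) (b' : 'Hom(Y, M)),
    [/\ is_hom a /\ is_hom a', is_hom b /\ is_hom b',
        cancel a' a, cancel b' b &
        (forall y, a (b' y) = 0) /\ (forall x, b (a' x) = 0)].
Proof.
case/iso_inverse=> f [g [fA gA fK gK]].
exists (dsum_fst X Y \o f)%VF, (g \o dsum_inl X Y)%VF.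
exists (dsum_snd X Y \o f)%VF, (g \o dsum_inr X Y)%VF.
split.
- by split; apply: is_hom_comp => //; [apply: dsum_fst_hom|apply: dsum_inl_hom].
- by split; apply: is_hom_comp => //; [apply: dsum_snd_hom|apply: dsum_inr_hom].
- by move=> x; rewrite !comp_lfunE gK dsum_fstE dsum_inlE.
- by move=> x; rewrite !comp_lfunE gK dsum_sndE dsum_inrE.
by split=> x;
  rewrite !comp_lfunE gK ?dsum_fstE ?dsum_sndE ?dsum_inlE ?dsum_inrE.
Qed.

(** The complement is the kernel of the retraction. *)
Lemma direct_summandP X M : direct_summand X M <->
  exists (u : 'Hom(X, M)) (v : 'Hom(M, X)),
    [/\ is_hom u, is_hom v & cancel u v].
Proof.
split=> [[Y /iso_dsum_maps[a [a' [b [b' [[aA aA'] _ aK _ _]]]]]]|].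
  by exists a', a.
move=> [u [v [uA vA uK]]].
have vS y : exists x, v x = y by exists (u y).
have [jA _ jI _ jP] := kernel_exact vA vS.
set j := submod_incl _ in jA jI jP.
pose Y := submod (submodule_ker vA).
have [|x|r rA rE] := hom_factor_inj (f := \1%VF - (u \o v)%VF) jA jI.
- exact: is_homB (@is_hom_id _ _ M) (is_hom_comp vA uA).
- by apply/jP; rewrite sub_lfunE id_lfunE comp_lfunE linearB /= uK subrr.
have [f fA fE] := hom_pair vA rA.
have [g gA gE] := hom_copair uA jA.
(* The isomorphism M -> X + ker v sends x to (v x, x - u (v x)). *)
have vj z : v (j z) = 0 by apply/jP; exists z.
have gK : cancel g f.
  move=> [x y]; rewrite fE gE /=.
  have E : v (u x + j y) = x by rewrite linearD /= uK vj addr0.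
  congr pair => //; apply: jI; rewrite rE sub_lfunE id_lfunE comp_lfunE E.
  by rewrite addrC addKr.
exists Y, f; split=> //; exists g => // x.
by rewrite gE fE /= rE sub_lfunE id_lfunE comp_lfunE addrC subrK.
Qed.

Lemma direct_summand_trans X Y Z :
  direct_summand X Y -> direct_summand Y Z -> direct_summand X Z.
Proof.
move=> /direct_summandP[u [v [uA vA uK]]].
move=> /direct_summandP[u' [v' [uA' vA' uK']]].
apply/direct_summandP; exists (u' \o u)%VF, (v \o v')%VF.
split; [exact: is_hom_comp | exact: is_hom_comp |].
by move=> x; rewrite !comp_lfunE uK' uK.
Qed.

Lemma summand_stable_retract X M : direct_summand X M -> stable_retract X M.
Proof.
by move=> /direct_summandP[u [v [uA vA uK]]]; apply: (retract_stable uA vA).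
Qed.

Lemma dim_proper_summand M X Y (a : 'Hom(M, X)) (a' : 'Hom(X, M))
    (b : 'Hom(M, Y)) (b' : 'Hom(Y, M)) :
    cancel a' a -> cancel b' b -> (forall y, a (b' y) = 0) -> ~ zero_module Y ->
  (\dim {:X} < \dim {:M})%N.
Proof.
move=> aK bK ab Y0; have -> : {:X}%VS = limg a.
  by apply/esym/surjectiveP => x; exists (a' x).
rewrite -(limg_ker_dim a fullv) -[X in (X < _)%N]add0n ltn_add2r lt0n dimv_eq0.
apply/negP=> /eqP k0; apply: Y0 => y; apply: (can_inj bK); rewrite linear0.
by apply/eqP; rewrite -memv0 -k0 memv_cap memvf memv_ker ab eqxx.
Qed.

(** Existence of decompositions into indecomposables, by induction on the
    dimension, packaged as an induction principle. *)
Lemma summand_induction (D : rmod A -> Prop) :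
    (forall M, zero_module M -> D M) ->
    (forall M X Y, iso M (dsum X Y) -> D X -> D Y -> D M) ->
  forall M, (forall X, direct_summand X M -> indecomposable X -> D X) -> D M.
Proof.
move=> D0 Ddsum M; have [d] := ubnP (\dim {:M}); elim: d M => // d IHd M.
rewrite ltnS => leMd DM.
have [M0|M0] := classic (zero_module M); first exact: D0.
have [indM|dec] := classic (indecomposable M).
  apply: DM => //; apply/direct_summandP; exists \1%VF, \1%VF.
  by split=> [||x]; [exact: is_hom_id | exact: is_hom_id | rewrite !id_lfunE].
have [X [Y [MXY X0 Y0]]] : exists X Y,
    [/\ iso M (dsum X Y), ~ zero_module X & ~ zero_module Y].
  apply: NNPP => no; apply: dec; split=> // X Y MXY.
  apply: NNPP => /not_or_and[X0 Y0].
  by apply: no; exists X, Y.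
have [a [a' [b [b' [[aA aA'] [bA bA'] aK bK [ab ba]]]]]] := iso_dsum_maps MXY.
apply: (Ddsum _ _ _ MXY); apply: IHd.
- exact: leq_trans (dim_proper_summand aK bK ab Y0) leMd.
- move=> Z ZX; apply: DM; apply: direct_summand_trans ZX _.
  by apply/direct_summandP; exists a', a.
- exact: leq_trans (dim_proper_summand bK aK ba X0) leMd.
move=> Z ZY; apply: DM; apply: direct_summand_trans ZY _.
by apply/direct_summandP; exists b', b.
Qed.

Lemma projective_retract P Q (u : 'Hom(P, Q)) (v : 'Hom(Q, P)) :
    is_hom u -> is_hom v -> cancel u v -> projective Q -> projective P.
Proof.
move=> uA vA uK Qp M N g f gA gS fA.
have [h [hA gh]] := Qp _ _ _ _ gA gS (is_hom_comp vA fA).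
exists (h \o u)%VF; split; first exact: is_hom_comp.
by apply/lfunP=> x; rewrite comp_lfunA gh !comp_lfunE uK.
Qed.

Lemma exists_min (T : Type) (D : T -> Prop) (m : T -> nat) :
  (exists x, D x) -> exists2 x, D x & forall y, D y -> (m x <= m y)%N.
Proof.
move=> [x Dx]; apply: NNPP => no.
have [k] := ubnP (m x); elim: k x Dx => // k IHk x Dx; rewrite ltnS => mxk.
apply: no; exists x => // y Dy; rewrite leqNgt; apply/negP => myx.
exact: IHk y Dy (leq_trans myx mxk).
Qed.

(** Among the endomorphisms h of a free cover q : F -> M with q h = q, take one
    of minimal rank.  As h h has the same property, h is injective on its
    image P, so that P is a direct summand of F, and it still maps onto M.  If a
    submodule U of P maps onto M, lifting P -> M through U yields an
    endomorphism over M of rank at most dim U; so U = P by minimality. *)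
Lemma projective_cover_exists M :
  exists P (p : 'Hom(P, M)), projective_cover p.
Proof.
pose F := free_rmod A (\dim {:M}); pose q : 'Hom(F, M) := free_cover M.
have qA : is_hom q := @free_cover_hom _ _ M.
have qS := @free_cover_surj _ _ M.
have Fp : projective F := @free_projective _ A _.
pose D (h : 'Hom(F, F)) := is_hom h /\ forall x, q (h x) = q x.
have [|h [hA qh] hmin] := @exists_min _ D (fun h => \dim (limg h)).
  by exists \1%VF; split=> [|x]; [exact: is_hom_id | rewrite id_lfunE].
(* Minimality of the rank: h h has the same rank as h, so ker h meets im h
   trivially. *)
have hI x : h (h x) = 0 -> h x = 0.
  have Dhh : D (h \o h)%VF.
    by split=> [|y]; [exact: is_hom_comp | rewrite comp_lfunE !qh].
  have := hmin _ Dhh; rewrite limg_comp -(limg_ker_dim h (limg h)).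
  rewrite -[X in (_ <= X)%N]add0n leq_add2r leqn0 dimv_eq0 => /eqP k0 hhx.
  apply/eqP; rewrite -memv0 -k0 memv_cap memv_img ?memvf //.
  by rewrite memv_ker hhx eqxx.
pose P := submod (submodule_img hA); pose i : 'Hom(P, F) := submod_incl _.
have iA : is_hom i := @submod_incl_hom _ _ _ _ _.
have iI : injective i := @submod_incl_inj _ _ _ _ _.
have iP x : x \in limg h <-> exists z, i z = x by exact: submod_inclP.
have [x|r rA rE] := hom_factor_inj (f := h) iA iI hA.
  by apply/iP; rewrite memv_img ?memvf.
(* As h is injective on its image P, the endomorphism r i of P is bijective. *)
have riI : lker (r \o i)%VF == 0%VS.
  apply/lker0P=> x y; rewrite !comp_lfunE => E; apply: iI.
  have /iP/memv_imgP[z _ zE] : exists t, i t = i x - i y.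
    by exists (x - y); rewrite linearB.
  apply/eqP; rewrite -subr_eq0 zE; apply/eqP/hI.
  by rewrite -zE linearB /= -!rE E subrr.
have riA : is_hom (r \o i)%VF by apply: is_hom_comp.
have [|x|s sA sE] := hom_factor_inj (f := \1%VF) riA (lker0P riI).
- exact: is_hom_id.
- have /memv_imgP[z _ zE] : x \in limg (r \o i)%VF.
    by rewrite lker0_limgf ?memvf.
  by exists z; rewrite -zE id_lfunE.
have Pp : projective P.
  apply: (@projective_retract _ _ (i \o s)%VF r _ rA _ Fp).
    exact: is_hom_comp.
  by move=> x; have := sE x; rewrite !comp_lfunE id_lfunE.
pose p : 'Hom(P, M) := (q \o i)%VF.
have pA : is_hom p by apply: is_hom_comp.
have pr x : p (r x) = q x by rewrite comp_lfunE rE qh.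
exists P, p; split=> //.
  by apply/surjectiveP=> y; have [x <-] := qS y; exists (r x).
move=> U subU Uk.
pose V := submod subU; pose k : 'Hom(V, P) := submod_incl subU.
have kA : is_hom k := @submod_incl_hom _ _ _ _ _.
have [|l lA lE] :=
  @proj_lift _ _ P V M (p \o k)%VF p Pp (is_hom_comp kA pA) _ pA.
  move=> y; have [x <-] := qS y.
  have /memv_addP[z zU [w wk E]] : r x \in (U + lker p)%VS by rewrite Uk memvf.
  have /(submod_inclP subU)[t tE] := zU.
  exists t; rewrite comp_lfunE [k t]tE -[RHS]pr E linearD /=.
  by move: wk; rewrite memv_ker => /eqP->; rewrite addr0.
pose m : 'Hom(F, P) := (k \o (l \o r))%VF.
have mU : (limg m <= U)%VS.
  apply/subvP=> _ /memv_imgP[x _ ->]; rewrite comp_lfunE.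
  by apply/(submod_inclP subU); exists ((l \o r)%VF x).
(* An endomorphism of F over M with image in U, to be compared with h. *)
have Dm : D (i \o m)%VF.
  split=> [|x]; first by do !apply: is_hom_comp.
  have := lE (r x); rewrite !comp_lfunE => ->.
  by rewrite -[q (i _)]comp_lfunE pr.
have dimi (W : {vspace P}) : \dim (i @: W) = \dim W.
  apply: limg_dim_eq; apply/eqP; rewrite -subv0; apply/subvP=> x.
  rewrite memv_cap memv0 memv_ker -(linear0 i) => /andP[_ /eqP/iI->].
  exact: eqxx.
have limgi : limg i = limg h.
  apply/vspaceP=> x; apply/idP/idP.
    by case/memv_imgP=> z _ ->; apply/iP; exists z.
  by case/iP=> z <-; rewrite memv_img ?memvf.
apply/eqP; rewrite eqEdim subvf /= -(dimi fullv) limgi.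
apply: leq_trans (hmin _ Dm) _; rewrite limg_comp dimi.
exact: dimvS.
Qed.

Lemma projective_cover_exact X P M (i : 'Hom(X, P)) (p : 'Hom(P, M)) :
  projective_cover p -> is_hom i -> lker i = 0%VS -> limg i = lker p ->
  short_exact i p.
Proof.
move=> [_ pA /surjectiveP pS _] iA /eqP/lker0P iI /exactP ip.
by split.
Qed.

Lemma syzygy_exists n M : exists X, syzygy n M X.
Proof.
elim: n => [|n [Y MY]].
  exists M, \1%VF; split; first exact: is_hom_id.
  by exists (fun x => x) => x; rewrite id_lfunE.
have [P [p pP]] := projective_cover_exists Y; have [_ pA pS _] := pP.
have [iA _ iI _ ip] := kernel_exact pA ((surjectiveP _).1 pS).
exists (submod (submodule_ker pA)), Y, P, p, (submod_incl (submodule_ker pA)).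
by split=> //; [apply/eqP/lker0P | apply/exactP].
Qed.

(** * Iterated syzygies of semi-Gorenstein-projective modules *)

(** The classes C_m: m-fold syzygies of sgp modules, up to stable retracts at
    each step. *)
Fixpoint stable_syzygies m X : Prop :=
  if m is m'.+1 then
    exists Y Z P (i : 'Hom(Z, P)) (p : 'Hom(P, Y)),
      [/\ stable_syzygies m' Y, projective P, short_exact i p &
          stable_retract X Z]
  else sgp X.

Lemma stable_syzygies_sgp m X : stable_syzygies m X -> sgp X.
Proof.
elim: m X => // m IHm X [Y [Z [P [i [p [/IHm Ysgp Pp ip XZ]]]]]].
exact: sgp_stable_retract XZ (sgp_syzygy Pp ip Ysgp).
Qed.

Lemma stable_syzygies_retract m X Y :
  stable_retract X Y -> stable_syzygies m Y -> stable_syzygies m X.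
Proof.
case: m => [|m] XY; first exact: sgp_stable_retract.
move=> [Y' [Z [P [i [p [Cm Pp ip YZ]]]]]]; exists Y', Z, P, i, p; split=> //.
exact: stable_retract_trans XY YZ.
Qed.

Lemma stable_syzygies_dsum m X Y :
  stable_syzygies m X -> stable_syzygies m Y -> stable_syzygies m (dsum X Y).
Proof.
elim: m X Y => [|m IHm] X Y; first exact: sgp_dsum.
move=> [M [Z [P [i [p [Cm Pp ip XZ]]]]]].
move=> [M' [Z' [P' [i' [p' [Cm' Pp' ip' XZ']]]]]].
have [j [q [jq _]]] := short_exact_dsum ip ip'.
exists (dsum M M'), (dsum Z Z'), (dsum P P'), j, q; split=> //.
- exact: IHm.
- exact: projective_dsum.
exact: stable_retract_dsum.
Qed.

(** The base case holds because syzygies and stable retracts of sgp modules are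
    sgp; the others follow by monotonicity of one step. *)
Lemma stable_syzygiesW m X : stable_syzygies m.+1 X -> stable_syzygies m X.
Proof.
elim: m X => [|m IHm] X; first exact: (@stable_syzygies_sgp 1).
by move=> [M [Z [P [i [p [/IHm Cm Pp ip XZ]]]]]]; exists M, Z, P, i, p.
Qed.

Lemma syzygy_stable_syzygies k l M X :
  syzygy k M X -> stable_syzygies l M -> stable_syzygies (k + l) X.
Proof.
elim: k X => [|k IHk] X.
  by case/iso_stable_retract=> XM _; apply: stable_syzygies_retract.
move=> [Y [P [p [i [MY pP iA i0 ip]]]]] /(IHk _ MY) CY.
exists Y, X, P, i, p; split=> //.
- by case: pP.
- exact: projective_cover_exact.
exact: stable_retract_refl.
Qed.

Lemma syzygy_sgp k M X : syzygy k M X -> sgp M -> sgp X.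
Proof.
move=> MX Msgp.
exact: stable_syzygies_sgp (@syzygy_stable_syzygies k 0 _ _ MX Msgp).
Qed.

(** Full faithfulness of the syzygy functor on sgp modules modulo projectives:
    a module whose k-th syzygy is a (k+l+1)-fold syzygy is itself an (l+1)-fold
    one. *)
Lemma syzygy_stable_syzygies_cancel k l M X :
  sgp M -> syzygy k M X -> stable_syzygies (k + l.+1) X ->
  stable_syzygies l.+1 M.
Proof.
move=> Msgp; elim: k X => [|k IHk] X.
  by case/iso_stable_retract=> _ MX; apply: stable_syzygies_retract.
move=> [Y [P [p [i [MY pP iA i0 ip]]]]] [N [Z [Q [j [q [CN Qp jq XZ]]]]]].
apply: (IHk _ MY); apply: (stable_syzygies_retract _ CN).
have Pp : projective P by case: pP.
have ipE := projective_cover_exact pP iA i0 ip.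
apply: (stable_retract_cosyzygy Pp Qp ipE jq _ _ XZ).
  exact: sgp_extends Pp ipE (syzygy_sgp MY Msgp).
exact: sgp_extends Qp jq (stable_syzygies_sgp CN).
Qed.

(** Each index that ever leaves the decreasing family has left it at some finite
    stage; go beyond all these stages. *)
Lemma decreasing_stabilises r (D : nat -> 'I_r -> Prop) n :
    (forall m j, D m.+1 j -> D m j) ->
  exists2 m, (n <= m)%N & forall j, D m j -> D m.+1 j.
Proof.
move=> Ddec; have Dle k l j : (k <= l)%N -> D l j -> D k j.
  by move=> /subnK <-; elim: (l - k)%N => // i IHi /Ddec/IHi.
(* N j is a stage at which j has left, if it ever does. *)
have [N NP] : exists N : 'I_r -> nat, forall j m, D (N j) j -> D m j.
  apply: (@fin_all_exists _ (fun=> nat) (fun j k => forall m, D k j -> D m j)).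
  move=> j; have [all|/not_all_ex_not[k Dk]] := classic (forall m, D m j).
    by exists 0%N.
  by exists k => m.
pose m := maxn n (\max_j N j); exists m; first exact: leq_maxl.
move=> j Dj; apply: NP; apply: Dle Dj.
by apply: leq_trans (leq_maxr _ _); apply: leq_bigmax.
Qed.

(** The finiteness argument: C_m and C_(m+1) agree on the finite list for some
    m >= n, and the m-th syzygy of M has all its indecomposable summands in the
    list. *)
Lemma sgp_stable_syzygy n M :
  phi_finite A n -> sgp M -> stable_syzygies 1 M.
Proof.
move=> [r [F phiF]] Msgp.
have [m nm stab] := @decreasing_stabilises r
  (fun m j => stable_syzygies m (F j)) n (fun m j => @stable_syzygiesW m (F j)).
have [M' MM'] := syzygy_exists (m - n) M; have M'sgp := syzygy_sgp MM' Msgp.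
have [S M'S] := syzygy_exists n M'; have Ssgp := syzygy_sgp M'S M'sgp.
(* S is the m-th syzygy of M, reached in m - n steps followed by n steps, so
   that its summands are summands of an n-th syzygy. *)
have CS : stable_syzygies m S.
  rewrite -(subnKC nm); apply: (syzygy_stable_syzygies M'S).
  by rewrite -[(m - n)%N]addn0; apply: (syzygy_stable_syzygies MM').
have {}CS : stable_syzygies m.+1 S.
  apply: summand_induction => [X X0 | X Y Z XYZ CY CZ | X XS indX].
  - exists S, (free_syzygy S), _, (free_syzygy_incl S), (free_cover S).
    split=> //; last exact: zero_stable_retract.
      exact: free_projective.
    exact: free_syzygy_exact.
  - apply: stable_syzygies_retract (stable_syzygies_dsum CY CZ).
    by case: (iso_stable_retract XYZ).
  have XSs := summand_stable_retract XS.
  have [|j /iso_stable_retract[XF FX]] := phiF X _ indX.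
    split; first exact: sgp_stable_retract XSs Ssgp.
    exact: Omega_summand M'S XS.
  apply: (stable_syzygies_retract XF); apply: stab.
  apply: (stable_syzygies_retract FX).
  exact: stable_syzygies_retract XSs CS.
rewrite -(subnKC nm) -addnS in CS.
have := syzygy_stable_syzygies_cancel M'sgp M'S CS.
rewrite -addn1; exact: syzygy_stable_syzygies_cancel.
Qed.

End Finiteness.

(** * The duality Hom(-, A) *)

Section Duality.
Variables (K : fieldType) (A : falgType K).
Implicit Types B L M N P Q R X Y Z : rmod A.
Local Notation A_A := (regular_rmod A).

Lemma dual_is_hom M (f : dual M) : is_hom (vsval f).
Proof. exact: (dual_spaceP _).1 (subvsP f). Qed.

Definition dual_elt M (f : 'Hom(M, A_A)) (fA : is_hom f) : dual M :=
  Subvs ((dual_spaceP f).2 fA).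

Lemma dual_inj M (f g : dual M) : (forall x, vsval f x = vsval g x) -> f = g.
Proof. by move=> fg; apply/val_inj/lfunP. Qed.

Lemma dual_actE M (f : dual M) (a : A) x :
  vsval (act f (a : A^c)) x = a * vsval f x.
Proof. by rewrite /= comp_lfunE lfunE. Qed.

Definition dual_map M N (u : 'Hom(M, N)) (uA : is_hom u) :
    'Hom(dual N, dual M) :=
  linfun (fun f : dual N => dual_elt (is_hom_comp uA (dual_is_hom f)) : dual M).

Lemma dual_mapE M N (u : 'Hom(M, N)) (uA : is_hom u) f x :
  vsval (dual_map uA f) x = vsval f (u x).
Proof.
rewrite linfun_ext => [|k g h]; first by rewrite /= comp_lfunE.
by apply: dual_inj => y; rewrite /= !(comp_lfunE, add_lfunE, scale_lfunE).
Qed.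

Lemma dual_map_hom M N (u : 'Hom(M, N)) (uA : is_hom u) : is_hom (dual_map uA).
Proof.
by move=> f a; apply: dual_inj => x; rewrite dual_mapE !dual_actE dual_mapE.
Qed.

Definition dual_ev M (x : M) : 'Hom(dual M, regular_rmod A^c) :=
  linfun (fun f : dual M => vsval f x : regular_rmod A^c).

Lemma dual_evE M (x : M) f : dual_ev x f = vsval f x.
Proof.
by rewrite linfun_ext // => k g h; rewrite /= add_lfunE scale_lfunE.
Qed.

Lemma dual_ev_hom M (x : M) : is_hom (dual_ev x).
Proof. by move=> f a; rewrite !dual_evE dual_actE. Qed.

Definition torsionless M :=
  forall x : M, (forall f : dual M, vsval f x = 0) -> x = 0.

Definition ev_surjective M :=
  forall g : 'Hom(dual M, regular_rmod A^c), is_hom g ->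
  exists x : M, forall f, g f = vsval f x.

Lemma projective_torsionless P : projective P -> torsionless P.
Proof.
move=> /projective_dual_basis[n [b [phi [phiA bphi]]]] x fx0.
rewrite -[x]bphi big1 // => j _.
by rewrite -[phi j]/(vsval (dual_elt (phiA j))) fx0 act0r.
Qed.

(** A functional f on P is the combination of the functionals of the dual basis
    with coefficients f (b j); so they form, with the evaluations at the b j, a
    dual basis of P*. *)
Lemma dual_basis_expansion P n b phi (bP : @has_dual_basis K A P n b phi)
    (f : dual P) :
  \sum_j act (dual_elt (bP.1 j)) (vsval f (b j) : A^c) = f.
Proof.
apply: dual_inj => x; rewrite -dual_evE linear_sum -[in RHS](bP.2 x) linear_sum.
apply: eq_bigr => j _ /=.
by rewrite dual_evE dual_actE dual_is_hom.
Qed.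

Lemma projective_dual P : projective P -> projective (dual P).
Proof.
move=> /projective_dual_basis[n [b [phi bP]]].
apply: (@dual_basis_projective _ _ _ n (fun j => dual_elt (bP.1 j))
  (fun j => dual_ev (b j))); split=> [j | f]; first exact: dual_ev_hom.
rewrite -[RHS](dual_basis_expansion bP); apply: eq_bigr => j _.
by rewrite dual_evE.
Qed.

Lemma projective_ev_surjective P : projective P -> ev_surjective P.
Proof.
move=> /projective_dual_basis[n [b [phi bP]]] g gA.
exists (\sum_j act (b j) (g (dual_elt (bP.1 j)))) => f.
rewrite -{1}[f](dual_basis_expansion bP) !linear_sum.
by apply: eq_bigr => j _ /=; rewrite gA dual_is_hom.
Qed.

Section DualExact.
Variables (X P M : rmod A) (i : 'Hom(X, P)) (p : 'Hom(P, M)).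
Hypotheses (iA : is_hom i) (pA : is_hom p).
Hypotheses (ip : short_exact i p) (exti : extends_along i A_A).

(** Surjectivity of P* -> X* is the extension property; the rest is left
    exactness of Hom. *)
Lemma dual_short_exact : short_exact (dual_map pA) (dual_map iA).
Proof.
have [_ _ _ pS pi] := ip.
split; [exact: dual_map_hom | exact: dual_map_hom | | |].
- move=> f g fg; apply: dual_inj => y; have [x <-] := pS y.
  by rewrite -!(dual_mapE pA) fg.
- move=> f; have [h hA hE] := exti (dual_is_hom f).
  by exists (dual_elt hA); apply: dual_inj => x; rewrite dual_mapE hE.
move=> f; split=> [f0 | [g <-]].
  have [x|h hA hE] := hom_factor_surj pA pS (dual_is_hom f).
    by case/pi=> z <-; rewrite -(dual_mapE iA) f0 zero_lfunE.
  by exists (dual_elt hA); apply: dual_inj => x; rewrite dual_mapE /= hE.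
apply: dual_inj => x; rewrite !dual_mapE zero_lfunE.
have -> : p (i x) = 0 by apply/pi; exists x.
exact: linear0.
Qed.

(** Restricted to P*, a map h : X* -> A is the evaluation at some x in P.  It
    vanishes on M*, so all functionals vanish at p x, hence p x = 0 and x comes
    from X. *)
Lemma ev_surjective_sub :
  projective P -> torsionless M -> ev_surjective X.
Proof.
move=> Pp Mt h hA; have [_ _ _ pS pi] := ip.
have [x xE] := projective_ev_surjective Pp (is_hom_comp (dual_map_hom iA) hA).
have [_ _ _ dS dE] := dual_short_exact.
have /pi[z zE] : p x = 0.
  apply: Mt => f; rewrite -(dual_mapE pA) -xE comp_lfunE.
  have -> : dual_map iA (dual_map pA f) = 0 by apply/dE; exists f.
  exact: linear0.
exists z => f; have [g <-] := dS f.
by rewrite dual_mapE zE -xE comp_lfunE.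
Qed.

(** A map M* -> A is the evaluation at a point of M, and the evaluation at a
    preimage of this point in P extends it. *)
Lemma ev_extends : projective P -> ev_surjective M ->
  extends_along (dual_map pA) (regular_rmod A^c).
Proof.
move=> Pp Me g gA; have [y yE] := Me g gA; have [_ _ _ pS _] := ip.
have [x xy] := pS y; exists (dual_ev x); first exact: dual_ev_hom.
by move=> f; rewrite dual_evE dual_mapE xy yE.
Qed.

End DualExact.
End Duality.

(** * Transposes *)

Section Transposes.
Variables (K : fieldType) (A : falgType K).
Implicit Types B L M N P Q R X Y Z : rmod A.
Local Notation A_A := (regular_rmod A).
Local Notation sgp := (@semi_Gorenstein_projective K A).

(** Adding to Z and P the projective module through which 1 - v u factors turns
    a stable retract into a genuine one. *)
Lemma retract_of_syzygy M : stable_syzygies 1 M ->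
  exists Y Z P (i : 'Hom(Z, P)) (p : 'Hom(P, Y))
      (u : 'Hom(M, Z)) (v : 'Hom(Z, M)),
    [/\ sgp Y, projective P, short_exact i p, is_hom u /\ is_hom v &
        cancel u v].
Proof.
move=> [Y [Z [P [i [p [Ysgp Pp ip]]]]]].
move=> [Q [u [v [s [t [Qp [uA vA] [sA tA] E]]]]]].
have [iA pA iI pS pi] := ip.
have [j jA jE] := hom_map_dsum iA (@is_hom_id _ _ Q).
have [a aA aE] := hom_pair uA sA.
have [b bA bE] := hom_copair vA tA.
exists Y, (dsum Z Q), (dsum P Q), j, (p \o dsum_fst P Q)%VF, a, b; split=> //.
- exact: projective_dsum.
- split=> //.
  + exact: is_hom_comp (@dsum_fst_hom _ _ P Q) pA.
  + by move=> [x y] [x' y']; rewrite !jE /= !id_lfunE => -[/iI-> ->].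
  + by move=> y; have [x <-] := pS y; exists (x, 0);
      rewrite comp_lfunE dsum_fstE.
  move=> [x y]; rewrite comp_lfunE dsum_fstE /= pi; split=> [] [z].
    by move=> <-; exists (z, y); rewrite jE /= id_lfunE.
  by rewrite jE => -[<- _]; exists z.1.
by move=> x; rewrite bE aE /= E.
Qed.

Hypothesis sgp_stable_syzygies : forall M, sgp M -> stable_syzygies 1 M.

(** By the hypothesis M embeds in a projective module. *)
Lemma sgp_torsionless M : sgp M -> torsionless M.
Proof.
case/sgp_stable_syzygies/retract_of_syzygy=> Y [Z [P [i [p [u [v]]]]]].
move=> [Ysgp Pp [iA pA iI _ _] [uA vA] uK] x fx0.
apply: (can_inj uK); apply: iI; rewrite !linear0.
apply: (projective_torsionless Pp) => f.
by have := fx0 (dual_map (is_hom_comp uA iA) f); rewrite dual_mapE comp_lfunE.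
Qed.

Lemma sgp_ev_surjective M : sgp M -> ev_surjective M.
Proof.
case/sgp_stable_syzygies/retract_of_syzygy=> Y [Z [P [i [p [u [v]]]]]].
move=> [Ysgp Pp ip [uA vA] uK] g gA; have [iA pA _ _ _] := ip.
have exti := sgp_extends Pp ip Ysgp.
have [z zE] := ev_surjective_sub iA pA ip exti Pp (sgp_torsionless Ysgp)
  (is_hom_comp (dual_map_hom uA) gA).
exists (v z) => f; rewrite -(dual_mapE vA) -zE comp_lfunE.
by congr (g _); apply: dual_inj => x; rewrite !dual_mapE uK.
Qed.

(** Coinduction over the class of duals of sgp modules: M* is a direct summand
    of Z*, whose syzygy Y* is in the class, and maps Y* -> A extend because they
    are evaluations. *)
Lemma sgp_dual M : sgp M -> semi_Gorenstein_projective (dual M).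
Proof.
move=> Msgp.
apply: (sgp_coinduction (C := fun T => exists2 M, sgp M & T = dual M) _
  (stable_retract_refl _)); last by exists M.
move=> _ [{Msgp}M Msgp ->].
have [Y [Z [P [i [p [u [v]]]]]]] :=
  retract_of_syzygy (sgp_stable_syzygies Msgp).
move=> [Ysgp Pp ip [uA vA] uK]; have [iA pA _ _ _] := ip.
have exti := sgp_extends Pp ip Ysgp.
exists (dual Z), (dual Y), (dual P), (dual_map pA), (dual_map iA); split.
- apply: (retract_stable (dual_map_hom vA) (dual_map_hom uA)) => f.
  by apply: dual_inj => x; rewrite !dual_mapE uK.
- exact: projective_dual.
- exact: dual_short_exact.
- exact: (ev_extends pA ip Pp (sgp_ev_surjective Ysgp)).
by exists Y.
Qed.

(** Let W be the image of d* : P0* -> P1*.  Then W is a syzygy of T and M* is a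
    syzygy of W.  Maps M* -> A extend to P0* since they are evaluations at
    points of M.  A map g : W -> A pulls back to P0* as the evaluation at some
    x; it vanishes on M*, so e x = 0 because M is torsionless, and x = d y; the
    evaluation at y extends g to P1*. *)
Lemma sgp_transpose M T :
  sgp M -> is_transpose M T -> semi_Gorenstein_projective T.
Proof.
move=> Msgp [P1 [P0 [d [e [q [[P1p P0p] [dA eA] [eS de] [qA qS] qE]]]]]].
have {}eS := (surjectiveP _).1 eS; have {}qS := (surjectiveP _).1 qS.
have {}de := (exactP _ _).1 de.
have {}qE f : q f = 0 <-> exists g, dual_map dA g = f.
  rewrite qE; split=> -[g gE]; exists g; last first.
    by apply/lfunP=> x; rewrite -gE dual_mapE comp_lfunE.
  by apply: dual_inj => x; rewrite dual_mapE gE comp_lfunE.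
have jq := kernel_exact qA qS; set j := submod_incl _ in jq.
set W := submod _ in j jq; have [jA _ jI _ jP] := jq.
have [|g|r rA rE] := hom_factor_inj (f := dual_map dA) jA jI.
- exact: dual_map_hom.
- by apply/jP/qE; exists g.
have rS w : exists g, r g = w.
  have /qE[g gE] : q (j w) = 0 by apply/jP; exists w.
  by exists g; apply: jI; rewrite rE.
have er : short_exact (dual_map eA) r.
  split=> //; first exact: dual_map_hom.
    move=> f g fg; apply: dual_inj => y; have [x <-] := eS y.
    by rewrite -!(dual_mapE eA) fg.
  move=> f; split=> [rf0 | [g <-]].
    have [x|h hA hE] := hom_factor_surj eA eS (dual_is_hom f).
      case/de=> y <-; rewrite -(dual_mapE dA) -rE rf0 linear0.
      exact: zero_lfunE.
    by exists (dual_elt hA); apply: dual_inj => x; rewrite dual_mapE /= hE.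
  apply: jI; rewrite rE linear0; apply: dual_inj => x.
  rewrite !dual_mapE zero_lfunE.
  have -> : e (d x) = 0 by apply/de; exists x.
  exact: linear0.
have exte : extends_along (dual_map eA) (regular_rmod A^c).
  move=> g gA; have [m mE] := sgp_ev_surjective Msgp gA.
  have [x xE] := eS m; exists (dual_ev x); first exact: dual_ev_hom.
  by move=> f; rewrite dual_evE dual_mapE xE mE.
have Wsgp := sgp_of_syzygy (projective_dual P0p) er exte (sgp_dual Msgp).
apply: (sgp_of_syzygy (projective_dual P1p) jq _ Wsgp) => g gA.
have [x xE] := projective_ev_surjective P0p (is_hom_comp rA gA).
have [_ _ _ _ erE] := er.
have /de[y yE] : e x = 0.
  apply: (sgp_torsionless Msgp) => f; rewrite -(dual_mapE eA) -xE comp_lfunE.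
  have -> : r (dual_map eA f) = 0 by apply/erE; exists f.
  exact: linear0.
exists (dual_ev y) => [|w]; first exact: dual_ev_hom.
have [f <-] := rS w; rewrite dual_evE rE dual_mapE yE -xE.
by rewrite comp_lfunE.
Qed.

End Transposes.

Theorem theorem1 (K : fieldType) (A : falgType K) (n : nat)
    (hconnected : connected_algebra A) (hnss : ~ semisimple_algebra A)
    (hn : (1 <= n)%N) (hfinite : phi_finite A n) :
  left_weakly_Gorenstein A.
Proof.
move=> M Msgp; split=> // T; apply: sgp_transpose Msgp => N.
exact: sgp_stable_syzygy hfinite.
Qed.
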